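(* There is a constant $C\in(0,\infty)$ depending only on the sub-Gaussian parameters $K$ and $\gamma$ of the noise such that the following holds. Assume $M_{\boldsymbol G}<1$, $\nu\ge 1/(1-M_{\boldsymbol G})$, and $$\lambda\ \ge\ C\,(M_{\boldsymbol G}+1)\,(a_{\mathrm{Lip}})^{2L}\,\|\boldsymbol x\|_n^2\,\Bigl(\frac{\sqrt2}{L}\Bigr)^{2L-1}\sqrt{\log(2P)}\;\frac{\log(2n)}{\sqrt n}.$$ Then, for $n$ large enough (the threshold being allowed to depend on all other quantities of the problem), every estimator $(\hat\kappa_{\mathfrak h},\hat\Omega_{\mathfrak h})$ with $$(\hat\kappa_{\mathfrak h},\hat\Omega_{\mathfrak h})\in\mathop{\arg\min}_{\kappa\in[0,\infty),\ \Omega\in\mathcal A_{\mathfrak h}}\Bigl\{\frac1n\sum_{i=1}^n\bigl(y_i-\kappa\,\mathfrak g_\Omega[\boldsymbol x_i]\bigr)^2+\lambda\kappa\Bigr\}$$ satisfies $$\operatorname{err}^2[\hat\kappa_{\mathfrak h}\,\mathfrak g_{\hat\Omega_{\mathfrak h}}]\ \le\ \inf_{\kappa\in[0,\infty),\ \Omega\in\mathcal A_{\mathfrak h}}\bigl\{\operatorname{err}^2[\kappa\,\mathfrak g_{\Omega}]+2\lambda\kappa\bigr\}$$ with probability at least $1-1/n$.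
   Context: Data: $y_i=\mathfrak g[\boldsymbol x_i]+u_i$, $i\in\{1,\dots,n\}$, with $(y_i,\boldsymbol x_i)\in\mathbb R\times\mathbb R^d$, $\mathfrak g:\mathbb R^d\to\mathbb R$ an unknown function, and $u_i$ real random noise variables that are independent, centered and uniformly sub-Gaussian: for constants $K,\gamma\in(0,\infty)$, $\max_{i}K^2\bigl(\mathbb E e^{|u_i|^2/K^2}-1\bigr)\le\gamma^2$. The inputs $\boldsymbol x_i$ are fixed and $\|\boldsymbol x\|_n:=\sqrt{\sum_{i=1}^n\|\boldsymbol x_i\|_2^2/n}$. Networks: $L$ is a positive integer, $p_0=d$, $p_1,\dots,p_L$ positive integers, $p_{L+1}=1$. The parameter space is $\mathcal A=\{\Theta=(\boldsymbol W^L,\dots,\boldsymbol W^0):\boldsymbol W^l\in\mathbb R^{p_{l+1}\times p_l}\}$, $P=\sum_{l=0}^L p_{l+1}p_l$ is the number of parameters, and $\mathfrak g_\Theta[\boldsymbol x]=\boldsymbol W^L\mathfrak f^L[\cdots\boldsymbol W^1\mathfrak f^1[\boldsymbol W^0\boldsymbol x]]$. The activation functions $\mathfrak f^l:\mathbb R^{p_l}\to\mathbb R^{p_l}$ satisfy $\mathfrak f^l[\boldsymbol 0]=\boldsymbol 0$, are $a_{\mathrm{Lip}}$-Lipschitz in Euclidean norm for a constant $a_{\mathrm{Lip}}\in[0,\infty)$, and are non-negative homogeneous of degree 1: $\mathfrak f^l[s\boldsymbol z]=s\,\mathfrak f^l[\boldsymbol z]$ for all $s\ge0$. Regularizer: $\boldsymbol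 G=(\boldsymbol G^L,\dots,\boldsymbol G^0)$ where each $\boldsymbol G^l$ is an (invertible or non-invertible) real matrix with $p_{l+1}$ columns; $\boldsymbol G\Theta:=(\boldsymbol G^L\boldsymbol W^L,\dots,\boldsymbol G^0\boldsymbol W^0)$; $\Pi_{\boldsymbol G}\Theta$ is the orthogonal projection of $\Theta$ onto $\ker(\boldsymbol G)$, i.e. each column of each $\boldsymbol W^l$ is projected orthogonally onto $\ker(\boldsymbol G^l)$. $\|\cdot\|_1$ of a matrix (or tuple of matrices) is the sum of absolute values of all entries. For a constant $\nu\in(0,\infty)$, $\mathfrak h[\Theta]:=\|\boldsymbol G\Theta\|_1+\nu\|\Pi_{\boldsymbol G}\Theta\|_1$ and $\mathcal A_{\mathfrak h}:=\{\Theta\in\mathcal A:\mathfrak h[\Theta]\le1\}$. Let $\bar{\boldsymbol G}^j:\ker(\boldsymbol G^j)^\perp\to\operatorname{Im}(\boldsymbol G^j)$ be the restriction of $\boldsymbol G^j$ (which is invertible) and $M_{\boldsymbol G}:=\max_{j\in\{0,\dots,L\}}\|(\bar{\boldsymbol G}^{j})^{-1}\|_{1\to1}$, where $\|\boldsymbol B\|_{1\to1}$ is the operator norm with respect to the $\ell_1$-norms, taken over the domain of $\boldsymbol B$ (and equal to $0$ if the domain is trivial). Prediction error: $\operatorname{err}[\kappa\mathfrak g_\Omega]:=\sqrt{\frac1n\sum_{i=1}^n(\mathfrak g[\boldsymbol x_i]-\kappa\mathfrak g_\Omega[\boldsymbol x_i])^2}$. $\lambda\in[0,\infty)$ is the tuning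 parameter. *)

(* Defs.v *)
From HB Require Import structures.
From mathcomp Require Import all_boot all_order all_algebra.
From mathcomp Require Import all_classical all_reals all_analysis.
Import Order.TTheory GRing.Theory Num.Theory.
Import numFieldNormedType.Exports.

Set Implicit Arguments.
Unset Strict Implicit.
Unset Printing Implicit Defensive.

Local Open Scope classical_set_scope.
Local Open Scope ring_scope.

(* The canonical norm of matrices is the sup norm, hence the two norms below. *)
Definition norm1 (R : realType) (m n : nat) (A : 'M[R]_(m, n)) : R :=
  \sum_(i < m) \sum_(j < n) `|A i j|.

Definition norm2 (R : realType) (n : nat) (z : 'cV[R]_n) : R :=
  Num.sqrt (\sum_(k < n) z k 0 ^+ 2).

Definition input_norm (R : realType) (d n : nat) (x : 'I_n -> 'cV[R]_d) : R :=
  Num.sqrt ((\sum_(i < n) norm2 (x i) ^+ 2) / n%:R).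

(* The widths are [p 0] (the input dimension), ..., [p L.+1] (which will be
   assumed to be 1); the values of [p] beyond [L.+1] play no role. *)
Definition params (R : realType) (L : nat) (p : nat -> nat) : Type :=
  forall l : 'I_L.+1, 'M[R]_(p l.+1, p l).

Definition nparams (L : nat) (p : nat -> nat) : nat :=
  (\sum_(l < L.+1) p l.+1 * p l)%N.

(* [layer f Theta x l _] is W^l f^l[ ... W^1 f^1[W^0 x]]; the member [f 0] of
   the family of activation functions is never used. *)
Fixpoint layer (R : realType) (L : nat) (p : nat -> nat)
    (f : forall l, 'cV[R]_(p l) -> 'cV[R]_(p l)) (Theta : params R L p)
    (x : 'cV[R]_(p 0%N)) (l : nat) : (l < L.+1)%N -> 'cV[R]_(p l.+1) :=
  match l with
  | 0 => fun lL => Theta (Ordinal lL) *m x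
  | k.+1 => fun lL =>
      Theta (Ordinal lL) *m f k.+1 (layer f Theta x (ltnW lL))
  end.

Definition network (R : realType) (L : nat) (p : nat -> nat)
    (pout : p L.+1 = 1%N) (f : forall l, 'cV[R]_(p l) -> 'cV[R]_(p l))
    (Theta : params R L p) (x : 'cV[R]_(p 0%N)) : R :=
  castmx (pout, erefl) (layer f Theta x (ltnSn L)) 0 0.

(* Orthogonality refers to the Euclidean inner product. *)
Definition ker_perp (R : realType) (m n : nat) (G : 'M[R]_(m, n)) :
    set 'cV[R]_n :=
  [set v | forall w : 'cV[R]_n, G *m w = 0 -> w^T *m v = 0].

(* The orthogonal projection of column vectors onto ker G.  The row space of
   [kermx G^T] is ker G, and that of [kermx (kermx G^T)^T] is its orthogonal
   complement. *)
Definition ker_proj (R : realType) (m n : nat) (G : 'M[R]_(m, n)) : 'M[R]_n :=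
  (proj_mx (kermx G^T) (kermx (kermx G^T)^T))^T.

Lemma ker_projP (R : realType) (m n : nat) (G : 'M[R]_(m, n)) (w : 'cV[R]_n) :
  G *m (ker_proj G *m w) = 0 /\ ker_perp G (w - ker_proj G *m w).
Proof.
set U := kermx G^T; set V := kermx U^T.
have UG : U *m G^T = 0 by exact: mulmx_ker.
have VU : V *m U^T = 0 by exact: mulmx_ker.
have eqT : ker_proj G *m w = (w^T *m proj_mx U V)^T.
  by rewrite [RHS]trmx_mul trmxK.
have dot0 (v : 'rV[R]_n) : v *m v^T = 0 -> v = 0.
  move=> /matrixP /(_ 0 0); rewrite !mxE => sum0.
  apply/rowP => k; rewrite mxE; apply/eqP; rewrite -sqrf_eq0 expr2; apply/eqP.
  have vk_ge0 (j : 'I_n) : true -> 0 <= v 0 j * v^T j 0.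
    by move=> _; rewrite mxE -expr2 sqr_ge0.
  move/eqP: sum0; rewrite psumr_eq0 // => /allP /(_ k).
  by rewrite mem_index_enum mxE => /(_ isT) /eqP.
have dx : (U :&: V = 0)%MS.
  apply/eqP/rowV0P => v; rewrite sub_capmx => /andP[/submxP[a vU] vV].
  apply: dot0; rewrite {2}vU trmx_mul mulmxA.
  by move/sub_kermxP: vV => ->; rewrite mul0mx.
have full : (w^T <= U + V)%MS.
  apply: submx_full; rewrite /row_full eqn_leq rank_leq_col /=.
  have := mxrank_sum_cap U V; rewrite dx mxrank0 addn0 => ->.
  by rewrite /V mxrank_ker mxrank_tr subnKC // rank_leq_col.
rewrite eqT; split.
  apply: trmx_inj; rewrite trmx_mul trmx0 trmxK.
  by apply/sub_kermxP; exact: proj_mx_sub.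
move=> z Gz.
have /submxP[b zU] : (z^T <= U)%MS.
  by apply/sub_kermxP; rewrite -trmx_mul Gz trmx0.
apply: trmx_inj; rewrite trmx_mul trmxK trmx0 linearB /= trmxK.
have := proj_mx_compl_sub full => /sub_kermxP compl0.
by rewrite -[z]trmxK zU trmx_mul mulmxA compl0 mul0mx.
Qed.

(* Operator norm with respect to the l1-norms of a map defined on a subspace
   [D]; it is 0 if [D] is trivial. *)
Definition opnorm11 (R : realType) (m n : nat) (D : set 'cV[R]_m)
    (B : 'cV[R]_m -> 'cV[R]_n) : R :=
  sup [set norm1 (B b) | b in [set b | D b /\ norm1 b <= 1]].

(* Inverse of the bijection ker(G)^perp -> Im(G) given by G; the values outside
   Im(G) play no role. *)
Definition restr_inv (R : realType) (m n : nat) (G : 'M[R]_(m, n)) :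
    'cV[R]_m -> 'cV[R]_n :=
  'pinv_(fun=> 0) (ker_perp G) (mulmx G).

(* Starting the maximum from 0 is harmless since the operator norms are
   nonnegative. *)
Definition M_reg (R : realType) (L : nat) (p m : nat -> nat)
    (G : forall l, 'M[R]_(m l, p l.+1)) : R :=
  \big[Num.max/0]_(j < L.+1)
    opnorm11 (range (mulmx (G j) : 'cV[R]_(p j.+1) -> 'cV[R]_(m j)))
      (restr_inv (G j)).

Definition reg (R : realType) (L : nat) (p m : nat -> nat)
    (G : forall l, 'M[R]_(m l, p l.+1)) (nu : R) (Theta : params R L p) : R :=
  \sum_(l < L.+1) norm1 (G l *m Theta l)
  + nu * \sum_(l < L.+1) norm1 (ker_proj (G l) *m Theta l).

Definition is_activation (R : realType) (k : nat) (aLip : R)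
    (phi : 'cV[R]_k -> 'cV[R]_k) : Prop :=
  [/\ phi 0 = 0,
      forall z z', norm2 (phi z - phi z') <= aLip * norm2 (z - z') &
      forall (s : R) z, 0 <= s -> phi (s *: z) = s *: phi z].

Definition feasible (R : realType) (L : nat) (p m : nat -> nat)
    (G : forall l, 'M[R]_(m l, p l.+1)) (nu : R) : set (R * params R L p) :=
  [set z | 0 <= z.1 /\ reg G nu z.2 <= 1].

Definition argmin (R : realType) (X : Type) (A : set X) (F : X -> R) : set X :=
  [set a | A a /\ forall b, A b -> F a <= F b].

Definition mean_sq (R : realType) (n : nat) (v : 'I_n -> R) : R :=
  n%:R^-1 * \sum_(i < n) v i ^+ 2.

Definition err (R : realType) (X : Type) (n : nat) (x : 'I_n -> X)
    (g h : X -> R) : R :=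
  Num.sqrt (mean_sq (fun i => g (x i) - h (x i))).

Definition objective (R : realType) (L : nat) (p : nat -> nat)
    (pout : p L.+1 = 1%N) (f : forall l, 'cV[R]_(p l) -> 'cV[R]_(p l))
    (n : nat) (x : 'I_n -> 'cV[R]_(p 0%N)) (y : 'I_n -> R) (lambda : R)
    (z : R * params R L p) : R :=
  mean_sq (fun i => y i - z.1 * network pout f z.2 (x i)) + lambda * z.1.

Definition independent_rvs (d : measure_display) (T : measurableType d)
    (R : realType) (P : probability T R) (n : nat) (u : 'I_n -> {RV P >-> R}) :
    Prop :=
  forall (J : {set 'I_n}) (B : 'I_n -> set R), (forall i, measurable (B i)) ->
  P (\bigcap_(i in [set` J]) u i @^-1` B i)
  = (\prod_(i in J) P (u i @^-1` B i))%E.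

(* The expectation may be infinite a priori, whence the extended reals. *)
Definition subgaussian (d : measure_display) (T : measurableType d)
    (R : realType) (P : probability T R) (K gamma : R) (n : nat)
    (u : 'I_n -> {RV P >-> R}) : Prop :=
  forall i, ((K ^+ 2)%:E *
    ('E_P[fun w => expR (`|u i w| ^+ 2 / K ^+ 2)] - 1) <= (gamma ^+ 2)%:E)%E.

(* Inner probability: equivalent to [q <= P A] when [A] is measurable; no
   measurability is assumed of estimators. *)
Definition prob_at_least (d : measure_display) (T : measurableType d)
    (R : realType) (P : probability T R) (A : set T) (q : R) : Prop :=
  exists E : set T, [/\ measurable E, E `<=` A & (q%:E <= P E)%E].

(* Main.v *)
(* By minimality of the estimator, the oracle inequality holds on the event that
   Z := sup_{reg Theta <= 1} |2/n sum_i u_i g_Theta(x_i)| <= lambda.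
   The threshold N may depend on everything but n, x, lambda and the noise, and
   on s := input_norm x antitonically.  Hence C = 1 is enough: the bound on
   lambda is of order s^2 log(2n) / sqrt n, whereas Z is of order
   s sqrt(log(2n) / n) with probability at least 1 - 1/n, the additional factor
   s sqrt(log(2n)) absorbing all constants.
   For the bound on Z: the sublevel set of the regularizer is bounded, since the
   components of Theta in ker G and in its orthogonal complement are both
   controlled; networks are Lipschitz in their parameters there; so a grid of
   mesh 1/n reduces the supremum to (2n)^b linear combinations of the noise,
   which are handled by Chernoff's bound.  Adding the u_i themselves to these
   linear combinations controls the discretization error. *)
Require Import Defs.
From HB Require Import structures.
From mathcomp Require Import all_boot all_order all_algebra.
From mathcomp Require Import all_classical all_reals all_analysis measurable_realfun.
From mathcomp Require Import ring lra zify.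
Import Order.TTheory GRing.Theory Num.Theory.
Import numFieldNormedType.Exports.

Set Implicit Arguments.
Unset Strict Implicit.
Unset Printing Implicit Defensive.

Local Open Scope classical_set_scope.
Local Open Scope ring_scope.

(** * Elementary inequalities for the exponential *)

(** After inversion this is a polynomial inequality, because exp(-x) is at least 1 - x, used for x
    <= 0, and at least (1 - x/2)^2, used for 0 < x <= 1. *)
Lemma expR_le_quad (R : realType) (x : R) : x <= 1 -> expR x <= 1 + x + 2 * x ^+ 2.
Proof.
move=> x1; have [x0|x0] := leP x 0.
  rewrite -[expR x]invrK -expRN -div1r ler_pdivrMr ?expR_gt0//.
  have h := expR_ge1Dx (- x).
  apply: (@le_trans _ _ ((1 + x + 2 * x ^+ 2) * (1 - x))); first nra.
  by rewrite ler_wpM2l//; nra.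
have h := expR_ge1Dx (- (x / 2)).
rewrite -[expR x]invrK -expRN -div1r ler_pdivrMr ?expR_gt0//.
have -> : - x = - (x / 2) + - (x / 2) by lra.
rewrite expRD.
apply: (@le_trans _ _ ((1 + x + 2 * x ^+ 2) * ((1 - x / 2) * (1 - x / 2)))).
  rewrite -subr_ge0.
  have -> : (1 + x + 2 * x ^+ 2) * ((1 - x / 2) * (1 - x / 2)) - 1
     = x ^+ 2 * ((1 - x) * (5/4 - x/2)) by field.
  by apply: mulr_ge0; [exact: sqr_ge0|apply: mulr_ge0; lra].
by rewrite ler_wpM2l// ?ler_pM//; nra.
Qed.

(** The linear term on the right is exactly x, so that it disappears when x is a centered random
    variable. *)
Lemma expR_le_add_expR_sqr (R : realType) (x : R) :
  expR x <= x + expR (2 * x ^+ 2).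
Proof.
have [x1|x1] := leP x 1.
  apply: (le_trans (expR_le_quad x1)).
  have := expR_ge1Dx (2 * x ^+ 2); lra.
apply: (@le_trans _ _ (expR (2 * x ^+ 2))); last lra.
by rewrite ler_expR; nra.
Qed.

(** Convexity: the tangent of exp at [a * y], evaluated at y and at 0 and averaged with weights a
    and 1 - a, gives the chord inequality. *)
Lemma expR_scale_le (R : realType) (a y : R) : 0 <= a <= 1 ->
  expR (a * y) <= 1 + a * (expR y - 1).
Proof.
move=> /andP[a0 a1].
set z := a * y.
have h1 : expR z * (1 + (y - z)) <= expR y.
  by rewrite -[leRHS](congr1 expR (subrKC z y)) expRD ler_wpM2l ?expR_ge0// expR_ge1Dx.
have h0 : expR z * (1 - z) <= 1.
  by rewrite -[leRHS](@expR0 R) -(subrr z) expRD ler_wpM2l ?expR_ge0// expR_ge1Dx.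
have : expR z = a * (expR z * (1 + (y - z))) + (1 - a) * (expR z * (1 - z)).
  by rewrite /z; ring.
nra.
Qed.

(** * Expectations of products of independent variables *)

Section factor_integral.

Import HBNNSimple.

(** The factorization for indicators extends to simple functions by linearity, and to [h] by
    monotone convergence along the increasing approximation [s]. *)
Lemma factor_integral d (T : measurableType d) (R : realType)
    (P : {measure set T -> \bar R}) (Y U : T -> R) (c : R) (h : R -> R) :
  measurable_fun setT Y -> measurable_fun setT U -> measurable_fun [set: R] h ->
  (forall w, 0 <= Y w) -> (forall r, 0 <= h r) -> 0 <= c ->
  (forall B, measurable B ->
     \int[P]_w (Y w * \1_B (U w))%:E = c%:E * P (U @^-1` B))%E ->
  (\int[P]_w (Y w * h (U w))%:E = c%:E * \int[P]_w (h (U w))%:E)%E.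
Proof.
move=> mY mU mh Y0 h0 c0 HB.
have mhE : measurable_fun [set: R] (EFin \o h) by exact/measurable_EFinP.
pose s := nnsfun_approx measurableT mhE.
have mB (n : nat) r : measurable (s n @^-1` [set r]) by [].
have mUB (B : set R) : measurable B -> measurable (U @^-1` B).
  by move=> mB'; rewrite -[_ @^-1` _]setTI; exact: mU.
have scvg w : (s n (U w))%:E @[n --> \oo] --> (h (U w))%:E.
  exact: (@cvg_nnsfun_approx _ _ _ _ measurableT _ mhE (fun r _ => h0 r)).
have smono m n w : (m <= n)%N -> s m (U w) <= s n (U w).
  by move=> mn; exact/lefP/nd_nnsfun_approx.
have msU n : measurable_fun setT (s n \o U) by exact: measurableT_comp.
have simple n : (\int[P]_w (Y w * s n (U w))%:E
    = c%:E * \int[P]_w (s n (U w))%:E)%E.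
  have mind r : measurable_fun setT (fun w => \1_(s n @^-1` [set r]) (U w) : R).
    exact: measurableT_comp.
  have rge0 r : r \in range (s n) -> 0 <= r by rewrite inE => -[x _ <-].
  have rind r x : 0 <= r * \1_(s n @^-1` [set r]) x :> R.
    rewrite indicE; case: (boolP (x \in _)) => [|_]; last by rewrite mulr0.
    by rewrite inE => /= <-; rewrite mulr1.
  have fin : finite_set (range (s n)) by [].
  (* Both sides decompose over the finitely many level sets of [s n]. *)
  transitivity (\sum_(r \in range (s n)) r%:E * (c%:E * P (U @^-1` (s n @^-1` [set r]))))%E.
    under eq_integral => w _.
      rewrite fimfunE fsbig_finite//= mulr_sumr -sumEFin -fsbig_finite//.
      over.
    rewrite ge0_integral_fsum//=; last 2 first.
    - move=> r; apply/measurable_EFinP; apply: measurable_funM => //.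
      exact: measurable_funM.
    - by move=> r w _; rewrite lee_fin mulr_ge0.
    apply: eq_fsbigr => r rs; rewrite -HB//.
    rewrite -ge0_integralZl//=; last 3 first.
    - by apply/measurable_EFinP; exact: measurable_funM.
    - by move=> w _; rewrite lee_fin mulr_ge0.
    - by rewrite lee_fin rge0.
    by apply: eq_integral => w _; rewrite -EFinM mulrCA.
  under [in RHS]eq_integral => w _.
    rewrite fimfunE fsbig_finite//= -sumEFin -fsbig_finite//.
    over.
  rewrite ge0_integral_fsum//=; last 2 first.
  - by move=> r; apply/measurable_EFinP; apply: measurable_funM.
  - by move=> r w _; rewrite lee_fin.
  rewrite !fsbig_finite//= ge0_sume_distrr.
    rewrite big_seq [in RHS]big_seq.
    apply: eq_bigr => r; rewrite in_fset_set// => rs.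
    rewrite muleCA; congr (_ * _)%E.
    under eq_integral do rewrite EFinM.
    rewrite ge0_integralZl//=; last by rewrite lee_fin rge0.
      by rewrite integral_indic// ?setIT//; exact: mUB.
    exact/measurable_EFinP.
  by move=> r _; apply: integral_ge0 => w _; rewrite lee_fin.
have cvgl : (\int[P]_w (Y w * s n (U w))%:E @[n --> \oo] -->
             \int[P]_w (Y w * h (U w))%:E)%E.
  have lim_eq w : (Y w * h (U w))%:E = limn (fun n => (Y w * s n (U w))%:E).
    apply/esym/cvg_lim => //.
    under eq_fun do rewrite EFinM.
    by rewrite EFinM; exact: cvgeZl.
  under eq_integral do rewrite lim_eq.
  apply: cvg_monotone_convergence => //.
  - by move=> n; apply/measurable_EFinP; apply: measurable_funM => //; exact: msU.
  - by move=> n w _; rewrite lee_fin mulr_ge0.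
  - by move=> w _ m n mn; rewrite lee_fin ler_wpM2l// smono.
have cvgr : (\int[P]_w (s n (U w))%:E @[n --> \oo] -->
             \int[P]_w (h (U w))%:E)%E.
  have lim_eq w : (h (U w))%:E = limn (fun n => (s n (U w))%:E).
    by apply/esym/cvg_lim => //.
  under eq_integral do rewrite lim_eq.
  apply: cvg_monotone_convergence => //.
  - by move=> n; apply/measurable_EFinP; exact: msU.
  - by move=> n w _; rewrite lee_fin.
  - by move=> w _ m n mn; rewrite lee_fin smono.
rewrite -(cvg_lim _ cvgl)//.
under eq_fun do rewrite simple.
by apply: cvg_lim => //; exact: cvgeZl.
Qed.

End factor_integral.

(* The functions [h i] replace indicators one index at a time. *)
Lemma indep_integral_prod d (T : measurableType d) (R : realType)
    (P : probability T R) n (u : 'I_n -> {RV P >-> R}) (h : 'I_n -> R -> R)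
    (M : 'I_n -> R) :
  independent_rvs u -> (forall i, measurable_fun [set: R] (h i)) ->
  (forall i r, 0 <= h i r) ->
  (forall i, \int[P]_w (h i (u i w))%:E = (M i)%:E)%E ->
  (\int[P]_w (\prod_i h i (u i w))%:E = (\prod_i M i)%:E)%E.
Proof.
move=> indep mh h0 hM.
have mu i : measurable_fun setT (u i) by [].
have mU i (B : set R) : measurable B -> measurable (u i @^-1` B).
  by move=> mB; rewrite -[_ @^-1` _]setTI; exact: mu.
have M0 i : 0 <= M i.
  by rewrite -lee_fin -hM; apply: integral_ge0 => w _; rewrite lee_fin.
(* In [F k], the first k factors are the functions [h i], the others are still indicators; [E k]
   holds the corresponding expectations. *)
pose F k (B : 'I_n -> set R) (i : 'I_n) (w : T) : R :=
  if (i < k)%N then h i (u i w) else \1_(B i) (u i w).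
pose E k (B : 'I_n -> set R) (i : 'I_n) : R :=
  if (i < k)%N then M i else fine (P (u i @^-1` B i)).
have F0 k B i w : 0 <= F k B i w by rewrite /F; case: ifP.
have E0 k B i : 0 <= E k B i by rewrite /E; case: ifP => // _; exact: fine_ge0.
have mF k B i : measurable (B i) -> measurable_fun setT (F k B i).
  move=> mB; rewrite /F; case: (i < k)%N; first exact: measurableT_comp.
  exact: (measurableT_comp (measurable_indic mB) (mu i)).
suff claim k : (k <= n)%N -> forall B, (forall i, measurable (B i)) ->
    (\int[P]_w (\prod_i F k B i w)%:E = (\prod_i E k B i)%:E)%E.
  have := claim n (leqnn n) (fun=> setT) (fun=> measurableT).
  have -> : (fun w => (\prod_i F n (fun=> setT) i w)%:E) =
            (fun w => (\prod_i h i (u i w))%:E).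
    by apply/funext => w; congr (_%:E); apply: eq_bigr => i _; rewrite /F ltn_ord.
  by move=> ->; congr (_%:E); apply: eq_bigr => i _; rewrite /E ltn_ord.
(* For k = 0 all factors are indicators, and the claim is independence for the full index set. *)
elim: k => [_ B mB|k IH kn B mB].
  transitivity (P (\bigcap_(i in [set` [set: 'I_n]%SET]) u i @^-1` B i)).
    rewrite -[X in P X]setIT -integral_indic//; last first.
      by apply: fin_bigcap_measurable => // i _; exact: mU.
    apply: eq_integral => w _; congr (_%:E); rewrite /F /=.
    rewrite [RHS]indicE; case: (boolP (w \in _)) => [|wn].
      rewrite inE => wB; rewrite big1// => i _.
      by rewrite indicE mem_set//; apply: wB; rewrite /= finset.in_setT.
    have [i wi] : exists i, ~ B i (u i w).
      apply/existsNP => wB; move/negP: wn; apply; rewrite inE => i _; exact: wB.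
    by rewrite (bigD1 i)//= indicE memNset// mul0r.
  rewrite indep// -prodEFin; apply: eq_big => [i|i _]; first by rewrite finset.in_setT.
  by rewrite /E /= fineK// fin_num_measure//; exact: mU.
pose o := Ordinal kn.
pose Y w := \prod_(i | i != o) F k B i w.
pose c := \prod_(i | i != o) E k B i.
have Fk1 i w : i != o -> F k.+1 B i w = F k B i w.
  by move=> io; rewrite /F ltnS leq_eqVlt -[_ == k]/(i == o) (negbTE io).
have Ek1 i : i != o -> E k.+1 B i = E k B i.
  by move=> io; rewrite /E ltnS leq_eqVlt -[_ == k]/(i == o) (negbTE io).
have -> : (fun w => (\prod_i F k.+1 B i w)%:E) = (fun w => (Y w * h o (u o w))%:E).
  apply/funext => w; congr (_%:E); rewrite (bigD1 o)//= mulrC; congr (_ * _).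
    by apply: eq_bigr => i io; exact: Fk1.
  by rewrite /F /= leqnn.
rewrite (bigD1 o)//= mulrC.
have -> : E k.+1 B o = M o by rewrite /E /= leqnn.
rewrite (eq_bigr _ Ek1) EFinM -hM.
apply: factor_integral => //.
- rewrite /Y; under eq_fun do rewrite -big_filter.
  by apply: measurable_prod => i _; exact: mF.
- by move=> w; exact: prodr_ge0.
- exact: prodr_ge0.
(* The induction hypothesis with [A] as the set at index [o] is the factorization for indicators
   that [factor_integral] asks for. *)
move=> A mA; pose B' i := if i == o then A else B i.
have mB' i : measurable (B' i) by rewrite /B'; case: ifP.
have := IH (ltnW kn) B' mB'.
have -> : (fun w => (\prod_i F k B' i w)%:E) = (fun w => (Y w * \1_A (u o w))%:E).
  apply/funext => w; congr (_%:E); rewrite (bigD1 o)//= mulrC; congr (_ * _).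
    by apply: eq_bigr => i io; rewrite /F /B' (negbTE io).
  by rewrite /F /B' /= ltnn eqxx.
move=> ->; rewrite (bigD1 o)//= mulrC EFinM; congr (_ * _)%E.
  by congr (_%:E); apply: eq_bigr => i io; rewrite /E /B' (negbTE io).
by rewrite /E /B' /= ltnn eqxx fineK// fin_num_measure//; exact: mU.
Qed.

(** * Moment generating functions and tails of the noise *)

(** Let y = X^2 / K^2. For small t, exp(t X) is at most t X + exp(2 t^2 K^2 y), where the first term
    is centered and the second is controlled by convexity. For large t, the inequality t X <= t^2
    K^2 / 2 + y / 2 suffices, without centering. The witness [M] records that the expectation is
    finite. *)
Lemma subgaussian_mgf d (T : measurableType d) (R : realType)
    (P : probability T R) (K gamma : R) (X : {RV P >-> R}) (t : R) :
  0 < K -> ('E_P[X] = 0)%E ->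
  ((K ^+ 2)%:E * ('E_P[fun w => expR (`|X w| ^+ 2 / K ^+ 2)] - 1)
     <= (gamma ^+ 2)%:E)%E ->
  exists M : R, (\int[P]_w (expR (t * X w))%:E = M%:E)%E /\
    M <= expR (t ^+ 2 * (K ^+ 2 + 2 * gamma ^+ 2)).
Proof.
move=> K0 X0 subG.
have mX : measurable_fun setT X by [].
have K20 : 0 < K ^+ 2 by rewrite exprn_gt0.
pose y w : R := `|X w| ^+ 2 / K ^+ 2.
have Xy w : X w ^+ 2 = y w * K ^+ 2.
  by rewrite /y real_normK ?num_real// divfK// gt_eqF.
have y0 w : 0 <= y w by rewrite /y divr_ge0// ?exprn_ge0// ltW.
have my : measurable_fun setT (fun w => expR (y w)).
  apply: measurableT_comp => //; rewrite /y; apply: measurable_funM => //.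
  by apply: measurable_funX; exact: measurableT_comp.
have mtX : measurable_fun setT (fun w => expR (t * X w)).
  by apply: measurableT_comp => //; exact: measurable_funM.
rewrite unlock in X0 subG.
(* An infinite expectation would make the left-hand side of the sub-Gaussian condition infinite. *)
have [r Er rG] : exists2 r : R, (\int[P]_w (expR (y w))%:E = r%:E)%E
    & K ^+ 2 * (r - 1) <= gamma ^+ 2.
  move: subG; rewrite -/(y _).
  have : (0 <= \int[P]_w (expR (y w))%:E)%E.
    by apply: integral_ge0 => w _; rewrite lee_fin expR_ge0.
  rewrite /y; case: (\int[P]_w _)%E => [r _|_|//].
    by rewrite -EFinB -EFinM lee_fin => rG; exists r.
  by rewrite addye// gt0_muley ?lte_fin// leye_eq.
have ie : P.-integrable setT (fun w => (expR (y w))%:E).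
  apply/integrableP; split; first exact/measurable_EFinP.
  under eq_integral do rewrite gee0_abs ?lee_fin ?expR_ge0//.
  by rewrite Er ltry.
(* With b = |X| / K, one has b <= 1 + b^2 <= exp(b^2), so |X| is dominated by K exp(y). *)
have iX : P.-integrable setT (fun w => (X w)%:E).
  have iKe : P.-integrable setT (fun w => (K * expR (y w))%:E).
    by under eq_fun do rewrite EFinM; exact: integrableZl.
  apply: le_integrable iKe => //; first exact/measurable_EFinP.
  move=> w _ /=; rewrite lee_fin (ger0_norm (mulr_ge0 (ltW K0) (expR_ge0 _))).
  have := expR_ge1Dx (y w); rewrite /y.
  set a := `|X w| => h.
  have a0 : 0 <= a by exact: normr_ge0.
  have aE : a = K * (a / K) by rewrite mulrC divfK// gt_eqF.
  rewrite {1}aE.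
  rewrite -expr_div_n in h *.
  rewrite ler_wpM2l ?(ltW K0)//; apply: le_trans h.
  set b := a / K; nra.
(* Integrating a pointwise bound that is affine in X and exp(y): the X-term has expectation zero. *)
have main (a b c : R) : (forall w, expR (t * X w) <= a * X w + (b + c * expR (y w))) ->
    exists M : R, (\int[P]_w (expR (t * X w))%:E = M%:E)%E /\ M <= b + c * r.
  move=> abc.
  have iaX : P.-integrable setT (fun w => (a * X w)%:E).
    by under eq_fun do rewrite EFinM; exact: integrableZl.
  have ice : P.-integrable setT (fun w => (c * expR (y w))%:E).
    by under eq_fun do rewrite EFinM; exact: integrableZl.
  have ib : P.-integrable setT (fun w => b%:E).
    exact: finite_measure_integrable_cst.
  have ibc : P.-integrable setT (fun w => (b + c * expR (y w))%:E).
    by under eq_fun do rewrite EFinD; exact: integrableD.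
  have : (\int[P]_w (expR (t * X w))%:E <= (b + c * r)%:E)%E.
    apply: (@le_trans _ _ (\int[P]_w (a * X w + (b + c * expR (y w)))%:E)%E).
      apply: ge0_le_integral => //.
      - exact/measurable_EFinP.
      - apply/measurable_EFinP; apply: measurable_funD; first exact: measurable_funM.
        by apply: measurable_funD => //; exact: measurable_funM.
      - by move=> w _; rewrite lee_fin; exact: abc.
    under eq_integral do rewrite !EFinD !EFinM.
    rewrite integralD//= integralZl//= X0 mule0 add0e.
    rewrite integralD//= integral_cst//= probability_setT mule1.
    by rewrite integralZl//= Er.
  have : (0 <= \int[P]_w (expR (t * X w))%:E)%E.
    by apply: integral_ge0 => w _; rewrite lee_fin expR_ge0.
  case: (\int[P]_w (expR (t * X w))%:E)%E => [M _|_|//].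
    by rewrite lee_fin => HM; exists M.
  by rewrite leye_eq.
have [tK|tK] := leP (2 * t ^+ 2 * K ^+ 2) 1.
  set al := 2 * t ^+ 2 * K ^+ 2 in tK.
  have al0 : 0 <= al by rewrite /al mulr_ge0 ?sqr_ge0// mulr_ge0 ?sqr_ge0.
  have [|M [EM HM]] := main t (1 - al) al.
    move=> w; apply: (le_trans (expR_le_add_expR_sqr _)); rewrite lerD2l.
    have -> : 2 * (t * X w) ^+ 2 = al * y w.
      by rewrite exprMn Xy /al; ring.
    have := @expR_scale_le R al (y w); rewrite al0 tK => /(_ isT); lra.
  exists M; split=> //; apply: (le_trans HM).
  apply: (le_trans _ (expR_ge1Dx _)).
  have -> : 1 - al + al * r = 1 + 2 * t ^+ 2 * (K ^+ 2 * (r - 1)) by rewrite /al; ring.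
  have t20 := sqr_ge0 t; nra.
pose c := expR (t ^+ 2 * K ^+ 2 / 2).
have [|M [EM HM]] := main 0 (c / 2) (c / 2).
  move=> w; rewrite mul0r add0r.
  have le1 : t * X w <= t ^+ 2 * K ^+ 2 / 2 + y w / 2.
    have Kn : K != 0 by rewrite gt_eqF.
    have h := sqr_ge0 (t * K - X w / K).
    have -> : y w = (X w / K) ^+ 2 by rewrite expr_div_n Xy mulfK// gt_eqF.
    have : t * X w = t * K * (X w / K) by field.
    nra.
  apply: (@le_trans _ _ (c * expR (y w / 2))); first by rewrite -expRD ler_expR.
  have half : (0 <= 2^-1 :> R) && (2^-1 <= 1 :> R) by apply/andP; split; lra.
  have := expR_scale_le (y w) half; rewrite [_ * y w]mulrC => h.
  apply: (@le_trans _ _ (c * (1 + 2^-1 * (expR (y w) - 1)))).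
    by rewrite ler_wpM2l ?expR_ge0.
  lra.
exists M; split=> //; apply: (le_trans HM).
apply: (@le_trans _ _ (c * expR (t ^+ 2 * gamma ^+ 2))); last first.
  rewrite -expRD ler_expR; have := sqr_ge0 t; have := sqr_ge0 gamma; nra.
have -> : c / 2 + c / 2 * r = c * (1 + (r - 1) / 2) by field.
rewrite ler_wpM2l ?expR_ge0//; apply: (le_trans _ (expR_ge1Dx _)).
(* If r > 1, the regime 1/2 < t^2 K^2 bounds (r - 1) / 2 by t^2 K^2 (r - 1), hence by t^2
   gamma^2. *)
rewrite lerD2l; have [r1|r1] := leP r 1.
  by apply: (@le_trans _ _ 0); [lra|rewrite mulr_ge0 ?sqr_ge0].
apply: (@le_trans _ _ (t ^+ 2 * (K ^+ 2 * (r - 1)))).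
  rewrite mulrA; nra.
by rewrite ler_wpM2l ?sqr_ge0.
Qed.

Lemma weighted_sum_tail d (T : measurableType d) (R : realType)
    (P : probability T R) (K gamma t : R) n (u : 'I_n -> {RV P >-> R})
    (v : 'I_n -> R) :
  0 < K -> independent_rvs u -> (forall i, 'E_P[u i] = 0)%E ->
  subgaussian K gamma u -> \sum_i v i ^+ 2 <= 1 -> 0 < t ->
  (P [set w | (t <= \sum_i v i * u i w)%R]
    <= (expR (- (t ^+ 2 / (4 * (K ^+ 2 + 2 * gamma ^+ 2)))))%:E)%E.
Proof.
move=> K0 indep u0 subG v1 t0.
set c := K ^+ 2 + 2 * gamma ^+ 2.
have c0 : 0 < c.
  by rewrite /c ltr_pwDl// ?exprn_gt0// mulr_ge0// sqr_ge0.
(* The minimizer of s^2 c - s t, the exponent in Chernoff's bound; the minimum is - t^2 / (4 c). *)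
pose s := t / (2 * c).
have s0 : 0 < s by rewrite /s divr_gt0// mulr_gt0.
have mgf i : {M : R | (\int[P]_w (expR (s * v i * u i w))%:E = M%:E)%E /\
    M <= expR ((s * v i) ^+ 2 * c)}.
  by apply/cid/subgaussian_mgf.
pose M i := projT1 (mgf i).
have [EM HM] : (forall i, \int[P]_w (expR (s * v i * u i w))%:E = (M i)%:E)%E /\
    (forall i, M i <= expR ((s * v i) ^+ 2 * c)).
  by split=> i; case: (projT2 (mgf i)).
pose S w := \sum_i v i * u i w.
have mS : measurable_fun setT S.
  by apply: measurable_sum => i; exact: measurable_funM.
pose X : {RV P >-> R} := HB.pack S (isMeasurableFun.Build _ _ _ _ S mS).
apply: (le_trans (@chernoff _ _ _ P X s t s0)).
have : ('M_P X s <= (expR (s ^+ 2 * c))%:E)%E.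
  rewrite /mmt_gen_fun unlock.
  have -> : (fun w => ((expR \o s \o* X) w)%:E) =
      (fun w => (\prod_i expR (s * v i * u i w))%:E).
    apply/funext => w; congr (_%:E); rewrite -expR_sum /= /S mulr_suml.
    by congr expR; apply: eq_bigr => i _; ring.
  rewrite (@indep_integral_prod _ _ _ P n u (fun i r => expR (s * v i * r)) M)//.
  - rewrite lee_fin.
    apply: (@le_trans _ _ (\prod_i expR ((s * v i) ^+ 2 * c))).
      apply: ler_prod => i _; rewrite HM andbT.
      by rewrite -lee_fin -EM; apply: integral_ge0 => w _; rewrite lee_fin expR_ge0.
    rewrite -expR_sum ler_expR -mulr_suml ler_wpM2r ?(ltW c0)//.
    under eq_bigr do rewrite exprMn.
    by rewrite -mulr_sumr ler_piMr// sqr_ge0.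
  - by move=> i; apply: measurableT_comp => //; exact: measurable_funM.
move=> h; apply: (@le_trans _ _ ((expR (s ^+ 2 * c))%:E * (expR (- (s * t)))%:E)%E).
  by rewrite lee_wpmul2r// lee_fin expR_ge0.
rewrite -EFinM lee_fin -expRD ler_expR /s le_eqVlt; apply/orP; left; apply/eqP.
by field; rewrite gt_eqF.
Qed.

(** A union bound over [F * bool], where the boolean is a sign that reduces the absolute value to
    one-sided tails; this is the origin of the factor 2. *)
Lemma weighted_sums_event d (T : measurableType d) (R : realType)
    (P : probability T R) (K gamma t : R) n (u : 'I_n -> {RV P >-> R})
    (F : finType) (v : F -> 'I_n -> R) :
  0 < K -> independent_rvs u -> (forall i, 'E_P[u i] = 0)%E ->
  subgaussian K gamma u -> (forall q, \sum_i v q i ^+ 2 <= 1) -> 0 < t ->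
  exists E : set T, [/\ measurable E,
    forall w q, E w -> `|\sum_i v q i * u i w| <= t &
    ((1 - 2 * #|F|%:R *
       expR (- (t ^+ 2 / (4 * (K ^+ 2 + 2 * gamma ^+ 2)))))%:E <= P E)%E].
Proof.
move=> K0 indep u0 subG v1 t0.
set e := expR _.
pose v' (q : F * bool) i := (-1) ^+ q.2 * v q.1 i.
pose A q := [set w | t <= \sum_i v' q i * u i w].
have mA q : measurable (A q).
  rewrite /A -[X in measurable X]setTI.
  have mS : measurable_fun setT (fun w => \sum_i v' q i * u i w).
    by apply: measurable_sum => i; exact: measurable_funM.
  have := mS measurableT `[t, +oo[%classic (measurable_itv _).
  congr measurable; congr (_ `&` _).
  by apply/seteqP; split=> w /=; rewrite in_itv/= andbT.
have mU : measurable (\bigcup_(q in [set: F * bool]) A q).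
  exact: fin_bigcup_measurable.
exists (~` \bigcup_(q in [set: F * bool]) A q); split.
- exact: measurableC.
- move=> w q nA; rewrite ler_norml lerNl; apply/andP; split.
    rewrite leNgt; apply/negP => h; apply: nA; exists (q, true) => //=.
    rewrite /A /v' /= (le_trans (ltW h))// -sumrN le_eqVlt; apply/orP; left.
    by apply/eqP; apply: eq_bigr => i _; rewrite expr1 mulN1r mulNr.
  rewrite leNgt; apply/negP => h; apply: nA; exists (q, false) => //=.
  rewrite /A /v' /= (le_trans (ltW h))// le_eqVlt; apply/orP; left.
  by apply/eqP; apply: eq_bigr => i _; rewrite expr0 mul1r.
rewrite probability_setC// EFinB leeB//.
apply: (@le_trans _ _ (\sum_(q \in [set: F * bool]) P (A q))%E).
  by apply: content_sub_fsum => //; exact: finite_finset.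
rewrite (fsbigE (index_enum (F * bool)%type)) ?index_enum_uniq//; last first.
  by move=> q _; rewrite mem_index_enum.
under eq_bigl do rewrite in_setT.
apply: (@le_trans _ _ (\sum_(q : F * bool) e%:E)%E).
  apply: lee_sum => q _; apply: weighted_sum_tail => //.
  apply: le_trans (v1 q.1); apply: ler_sum => i _.
  by rewrite /v' exprMn sqrr_sign mul1r.
rewrite sumEFin lee_fin sumr_const card_prod card_bool -[leLHS]mulr_natl.
by rewrite natrM [_ * 2]mulrC.
Qed.

(** * Entrywise l1-norms and Euclidean norms *)

Lemma ler_norm1 (R : realType) m n (A : 'M[R]_(m, n)) i j : `|A i j| <= norm1 A.
Proof.
rewrite /norm1 (bigD1 i)//= (bigD1 j)//= -addrA lerDl.
by rewrite addr_ge0 ?sumr_ge0// => k _; rewrite sumr_ge0.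
Qed.

Lemma norm1_ge0 (R : realType) m n (A : 'M[R]_(m, n)) : 0 <= norm1 A.
Proof. by apply: sumr_ge0 => i _; apply: sumr_ge0. Qed.

Lemma norm1D (R : realType) m n (A B : 'M[R]_(m, n)) :
  norm1 (A + B) <= norm1 A + norm1 B.
Proof.
rewrite /norm1 -big_split; apply: ler_sum => i _.
rewrite -big_split; apply: ler_sum => j _.
by rewrite mxE ler_normD.
Qed.

Lemma norm1M (R : realType) m n k (A : 'M[R]_(m, n)) (B : 'M[R]_(n, k)) :
  norm1 (A *m B) <= norm1 A * norm1 B.
Proof.
rewrite /norm1 mulr_suml; apply: ler_sum => i _.
apply: (@le_trans _ _ (\sum_(j < k) \sum_(l < n) `|A i l| * `|B l j|)).
  apply: ler_sum => j _; rewrite mxE (le_trans (ler_norm_sum _ _ _))//.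
  by apply: ler_sum => l _; rewrite normrM.
rewrite exchange_big mulr_suml; apply: ler_sum => l _.
rewrite -mulr_sumr ler_wpM2l//.
rewrite [leRHS](bigD1 l)//= lerDl.
by rewrite sumr_ge0// => a _; rewrite sumr_ge0.
Qed.

Lemma norm2_ge0 (R : realType) n (z : 'cV[R]_n) : 0 <= norm2 z.
Proof. exact: sqrtr_ge0. Qed.

Lemma sqr_norm2 (R : realType) n (z : 'cV[R]_n) :
  norm2 z ^+ 2 = \sum_(k < n) z k 0 ^+ 2.
Proof. by rewrite sqr_sqrtr// sumr_ge0// => i _; rewrite sqr_ge0. Qed.

Lemma norm1_le_norm2 (R : realType) n (z : 'cV[R]_n) : norm1 z <= n%:R * norm2 z.
Proof.
have -> : n%:R * norm2 z = \sum_(i < n) norm2 z.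
  by rewrite sumr_const card_ord mulr_natl.
apply: ler_sum => i _.
rewrite big_ord1 -(ler_pXn2r (_ : 0 < 2)%N) ?nnegrE ?norm2_ge0// sqr_norm2.
rewrite real_normK ?num_real// (bigD1 i)//= lerDl.
by rewrite sumr_ge0// => j _; rewrite sqr_ge0.
Qed.

Lemma norm2_le_norm1 (R : realType) n (z : 'cV[R]_n) : norm2 z <= norm1 z.
Proof.
rewrite -(ler_pXn2r (_ : 0 < 2)%N) ?nnegrE ?norm2_ge0 ?norm1_ge0// sqr_norm2.
rewrite expr2 {1}/norm1 mulr_suml; apply: ler_sum => i _.
by rewrite big_ord1 -real_normK ?num_real// expr2 ler_wpM2l// ler_norm1.
Qed.

(** Passing from the Euclidean norm to the l1-norm costs the dimension k as a factor; such factors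
    only affect the threshold on n. *)
Lemma activation_lip1 (R : realType) k a (phi : 'cV[R]_k -> 'cV[R]_k) z z' :
  0 <= a -> is_activation a phi ->
  norm1 (phi z - phi z') <= k%:R * a * norm1 (z - z').
Proof.
move=> a0 [_ lip _]; apply: (le_trans (norm1_le_norm2 _)).
rewrite -mulrA ler_wpM2l// (le_trans (lip z z'))// ler_wpM2l//.
exact: norm2_le_norm1.
Qed.

Lemma activation_norm1 (R : realType) k a (phi : 'cV[R]_k -> 'cV[R]_k) z :
  0 <= a -> is_activation a phi -> norm1 (phi z) <= k%:R * a * norm1 z.
Proof.
move=> a0 act; have := activation_lip1 z 0 a0 act.
by case: act => -> _ _; rewrite !subr0.
Qed.

(** * Boundedness of the sublevel set of the regularizer *)

(* [1 - ker_proj G] vanishes on ker G. *)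
Lemma ker_proj_compl (R : realType) m n (G : 'M[R]_(m, n)) :
  exists A : 'M[R]_(n, m), 1%:M - ker_proj G = A *m G.
Proof.
apply/submxP; rewrite submxE; apply/eqP.
have GC : G *m cokermx G = 0 by exact: mulmx_coker.
apply/matrixP => i j; rewrite [RHS]mxE.
(* The columns [w] of [cokermx G] lie in ker G, so [w] minus its projection lies both in ker G and
   in its orthogonal complement, and is zero. *)
pose w : 'cV[R]_n := col j (cokermx G).
have Gw : G *m w = 0 by rewrite /w colE mulmxA GC mul0mx.
have [Gp perp] := ker_projP G w.
set z := w - _ in perp.
have Gz : G *m z = 0 by rewrite /z mulmxBr Gw Gp subrr.
have zz := perp z Gz.
have z2 : norm2 z ^+ 2 = 0.
  have := congr1 (fun M : 'M[R]_1 => M 0 0) zz; rewrite [LHS]mxE [RHS]mxE => zz0.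
  rewrite sqr_norm2 -[RHS]zz0.
  by apply: eq_bigr => k _; rewrite [z^T _ _]mxE expr2.
have : `|z i 0| <= 0.
  apply: (le_trans (ler_norm1 _ _ _)); apply: (le_trans (norm1_le_norm2 _)).
  by move/eqP: z2; rewrite sqrf_eq0 => /eqP ->; rewrite mulr0.
rewrite normr_le0 => /eqP; rewrite /z -{1}[w]mul1mx -mulmxBl => h.
rewrite -[RHS]h [LHS]mxE [RHS]mxE; apply: eq_bigr => k _.
by rewrite /w [col _ _ _ _]mxE.
Qed.

(** Each weight matrix is its projection onto ker G, of norm at most 1 / nu, plus [A l] applied to
    [G l *m Theta l], which has norm at most 1. *)
Lemma reg_bounded (R : realType) (L : nat) (p m : nat -> nat)
    (G : forall l, 'M[R]_(m l, p l.+1)) (nu : R) : 0 < nu ->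
  exists B : R, 0 <= B /\ forall Theta : params R L p, reg G nu Theta <= 1 ->
    forall l, norm1 (Theta l) <= B.
Proof.
move=> nu0.
pose A l := projT1 (cid (ker_proj_compl (G l))).
have AE l : 1%:M - ker_proj (G l) = A l *m G l by exact: (projT2 (cid (ker_proj_compl (G l)))).
exists (nu^-1 + \sum_(l < L.+1) norm1 (A l)); split.
  by rewrite addr_ge0 ?invr_ge0 ?(ltW nu0)// sumr_ge0// => l _; exact: norm1_ge0.
move=> Theta; rewrite /reg; set S1 := \sum_(l < L.+1) norm1 (G l *m Theta l).
set S2 := \sum_(l < L.+1) norm1 (ker_proj (G l) *m Theta l) => reg1 l.
have S10 : 0 <= S1 by rewrite sumr_ge0// => i _; exact: norm1_ge0.
have S20 : 0 <= S2 by rewrite sumr_ge0// => i _; exact: norm1_ge0.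
have S11 : S1 <= 1 by nra.
have S21 : S2 <= nu^-1 by rewrite -[leRHS]mul1r ler_pdivlMr// mulrC; nra.
have -> : Theta l = ker_proj (G l) *m Theta l + A l *m (G l *m Theta l).
  by rewrite mulmxA -AE mulmxBl mul1mx addrC subrK.
apply: (le_trans (norm1D _ _)); apply: lerD.
  apply: le_trans S21; rewrite /S2 (bigD1 l)//= lerDl.
  by rewrite sumr_ge0// => i _; exact: norm1_ge0.
apply: (le_trans (norm1M _ _)); apply: (@le_trans _ _ (norm1 (A l) * 1)).
  rewrite ler_wpM2l ?norm1_ge0//; apply: le_trans S11.
  by rewrite /S1 (bigD1 l)//= lerDl sumr_ge0// => i _; exact: norm1_ge0.
rewrite mulr1 [leRHS](bigD1 l)//= lerDl.
by rewrite sumr_ge0// => i _; exact: norm1_ge0.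
Qed.

(** * Growth of networks and Lipschitz continuity in the parameters *)

(** Induction over the layers; the difference of two networks splits as W (f z - f z') + (W - W') f
    z', where the first term uses the Lipschitz bound and the second the growth bound of the
    previous layer. *)
Lemma layer_bounds (R : realType) (L : nat) (p : nat -> nat)
    (f : forall l, 'cV[R]_(p l) -> 'cV[R]_(p l)) (a B : R) :
  0 <= a -> 0 <= B ->
  (forall l, (1 <= l <= L)%N -> is_activation a (f l)) ->
  forall l (lL : (l < L.+1)%N), exists A C : R, [/\ 0 <= A, 0 <= C,
    forall (Theta : params R L p) x, (forall l, norm1 (Theta l) <= B) ->
      norm1 (layer f Theta x lL) <= A * norm1 x &
    forall (Theta Theta' : params R L p) x e, 0 <= e ->
      (forall l, norm1 (Theta l) <= B) -> (forall l, norm1 (Theta' l) <= B) ->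
      (forall l, norm1 (Theta l - Theta' l) <= e) ->
      norm1 (layer f Theta x lL - layer f Theta' x lL) <= C * e * norm1 x].
Proof.
move=> a0 B0 act; elim=> [|k IH] lL.
  exists B, 1; split=> //.
    move=> Theta x ThB /=.
    apply: (le_trans (norm1M _ _)).
    by rewrite ler_wpM2r ?norm1_ge0//; exact: (ThB (Ordinal lL)).
  move=> Theta Theta' x e e0 _ _ The /=.
  rewrite -mulmxBl mul1r; apply: (le_trans (norm1M _ _)).
  by rewrite ler_wpM2r ?norm1_ge0//; exact: (The (Ordinal lL)).
have [A [C [A0 C0 bndA lipC]]] := IH (ltnW lL).
have actk : is_activation a (f k.+1) by apply: act.
pose c := (p k.+1)%:R * a.
have c0 : 0 <= c by rewrite mulr_ge0.
exists (B * (c * A)), (B * (c * C) + c * A); split.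
- by rewrite !mulr_ge0.
- by rewrite addr_ge0 ?mulr_ge0.
- move=> Theta x ThB /=; apply: (le_trans (norm1M _ _)); rewrite -mulrA.
  apply: ler_pM; rewrite ?norm1_ge0//; first exact: (ThB (Ordinal lL)).
  apply: (le_trans (activation_norm1 _ a0 actk)).
  by rewrite -/c -?[c * A * _]mulrA ler_wpM2l// bndA.
move=> Theta Theta' x e e0 ThB ThB' The /=.
set z := layer f Theta x _; set z' := layer f Theta' x _.
set W := Theta _; set W' := Theta' _.
have -> : W *m f k.+1 z - W' *m f k.+1 z' =
    W *m (f k.+1 z - f k.+1 z') + (W - W') *m f k.+1 z'.
  by rewrite mulmxBr mulmxBl addrA subrK.
apply: (le_trans (norm1D _ _)); rewrite !mulrDl; apply: lerD.
  apply: (le_trans (norm1M _ _)); rewrite -!mulrA; apply: ler_pM; rewrite ?norm1_ge0//.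
    exact: (ThB (Ordinal lL)).
  apply: (le_trans (activation_lip1 _ _ a0 actk)).
  by rewrite -/c -!mulrA !ler_wpM2l// mulrA lipC.
apply: (le_trans (norm1M _ _)); rewrite mulrAC [_ * e]mulrC mulrAC -mulrA.
apply: ler_pM; rewrite ?norm1_ge0//; first exact: (The (Ordinal lL)).
apply: (le_trans (activation_norm1 _ a0 actk)).
by rewrite ler_wpM2l// mulrC bndA.
Qed.

Lemma network_bounds (R : realType) (L : nat) (p : nat -> nat)
    (pout : p L.+1 = 1%N) (f : forall l, 'cV[R]_(p l) -> 'cV[R]_(p l))
    (a B : R) :
  0 <= a -> 0 <= B ->
  (forall l, (1 <= l <= L)%N -> is_activation a (f l)) ->
  exists A C : R, [/\ 0 <= A, 0 <= C,
    forall (Theta : params R L p) x, (forall l, norm1 (Theta l) <= B) ->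
      `|network pout f Theta x| <= A * norm2 x &
    forall (Theta Theta' : params R L p) x e, 0 <= e ->
      (forall l, norm1 (Theta l) <= B) -> (forall l, norm1 (Theta' l) <= B) ->
      (forall l, norm1 (Theta l - Theta' l) <= e) ->
      `|network pout f Theta x - network pout f Theta' x| <= C * e * norm2 x].
Proof.
move=> a0 B0 act; have [A [C [A0 C0 bndA lipC]]] := layer_bounds a0 B0 act (ltnSn L).
exists (A * (p 0)%:R), (C * (p 0)%:R); split; rewrite ?mulr_ge0//.
  move=> Theta x ThB; rewrite /network castmxE -mulrA.
  apply: (le_trans (ler_norm1 _ _ _)); apply: (le_trans (bndA _ _ ThB)).
  by rewrite ler_wpM2l// norm1_le_norm2.
move=> Theta Theta' x e e0 ThB ThB' The; rewrite /network !castmxE.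
have := ler_norm1 (layer f Theta x (ltnSn L) - layer f Theta' x (ltnSn L))
  (cast_ord (esym pout) 0) (cast_ord (esym erefl) 0).
rewrite !mxE => h; apply: (le_trans h).
apply: (le_trans (lipC _ _ _ _ e0 ThB ThB' The)).
by rewrite [C * _ * e]mulrAC -[leRHS]mulrA ler_wpM2l ?mulr_ge0// norm1_le_norm2.
Qed.

(** An activation with Lipschitz constant 0 and value 0 at the origin vanishes identically; as L >
    0, the output layer is preceded by one. *)
Lemma network_lip0 (R : realType) (L : nat) (p : nat -> nat)
    (pout : p L.+1 = 1%N) (f : forall l, 'cV[R]_(p l) -> 'cV[R]_(p l))
    (Theta : params R L p) x :
  (0 < L)%N -> (forall l, (1 <= l <= L)%N -> is_activation 0 (f l)) ->
  network pout f Theta x = 0.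
Proof.
case: L pout Theta => // L pout Theta _ act.
rewrite /network castmxE /=; set z := layer _ _ _ _.
have act0 : is_activation 0 (f L.+1) by apply: act; rewrite leqnn.
have -> : f L.+1 z = 0.
  apply/colP => i; apply/eqP; rewrite mxE -normr_le0.
  apply: (le_trans (ler_norm1 _ _ _)).
  by have := activation_norm1 z (lexx 0) act0; rewrite mulr0 mul0r.
by rewrite mulmx0 mxE.
Qed.

(** * Finite nets of networks *)

(** The points j / n - D cover [-D, D] with mesh 1 / n; the index is the integer part of (r + D)
    n. *)
Lemma grid_approx (R : realType) (D n : nat) (r : R) : (0 < n)%N -> `|r| <= D%:R ->
  exists j : 'I_(2 * D * n).+1, `|r - (j%:R / n%:R - D%:R)| <= n%:R^-1.
Proof.
move=> n0; rewrite ler_norml => /andP[rl ru].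
have n0R : 0 < n%:R :> R by rewrite ltr0n.
set s := (r + D%:R) * n%:R.
have s0 : 0 <= s by rewrite mulr_ge0// -lerBlDr sub0r.
have /andP[sl su] := truncn_itv s0.
have jb : (Num.truncn s < (2 * D * n).+1)%N.
  rewrite ltnS -(ler_nat R); apply: (le_trans sl).
  by rewrite /s !natrM ler_wpM2r//; lra.
exists (Ordinal jb) => /=; set j := (Num.truncn s)%:R in sl *.
have -> : r - (j / n%:R - D%:R) = (s - j) / n%:R by rewrite /s; field; rewrite gt_eqF.
have ni : 0 <= n%:R^-1 :> R by rewrite invr_ge0.
rewrite normrM ger0_norm ?subr_ge0// ger0_norm// ler_piMl//.
by rewrite lerBlDr /j nat1r ltW.
Qed.

Lemma natr_norm1_le (R : realType) m n (A : 'M[R]_(m, n)) c :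
  (forall i j, `|A i j| <= c) -> norm1 A <= (m * n)%N%:R * c.
Proof.
move=> Ac; apply: (@le_trans _ _ (\sum_(i < m) \sum_(j < n) c)).
  by apply: ler_sum => i _; exact: ler_sum.
by rewrite !sumr_const !card_ord mulrC natrM mulrA -mulrnA mulnC mulr_natr mulrnA mulr_natr.
Qed.

(** Every entry of every weight matrix is rounded to the grid. The constants [A], [C] and [b] are
    fixed before n, so the net grows only polynomially in n. *)
Lemma network_net (R : realType) (L : nat) (p : nat -> nat)
    (pout : p L.+1 = 1%N) (f : forall l, 'cV[R]_(p l) -> 'cV[R]_(p l))
    (a B : R) :
  0 <= a -> 0 <= B ->
  (forall l, (1 <= l <= L)%N -> is_activation a (f l)) ->
  exists A C : R, exists b : nat, [/\ 0 <= A, 0 <= C &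
    forall n, (0 < n)%N -> exists (F : finType) (Theta_ : F -> params R L p),
    [/\ (#|F| <= (2 * n) ^ b)%N,
      forall q x, `|network pout f (Theta_ q) x| <= A * norm2 x &
      forall Theta : params R L p, (forall l, norm1 (Theta l) <= B) ->
        exists q, forall x,
        `|network pout f Theta x - network pout f (Theta_ q) x|
          <= C / n%:R * norm2 x]].
Proof.
move=> a0 B0 act.
pose D := (Num.truncn B).+1.
have BD : B <= D%:R by rewrite ltW// truncnS_gt.
pose S : finType := {l : 'I_L.+1 & ('I_(p l.+1) * 'I_(p l))%type}.
pose c : R := \sum_(l < L.+1) (p l.+1 * p l)%N%:R.
have cl (l : 'I_L.+1) : (p l.+1 * p l)%N%:R <= c.
  by rewrite /c (bigD1 l)//= lerDl sumr_ge0.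
have c0 : 0 <= c by exact: sumr_ge0.
(* Grid points can leave the ball of radius [B]; since their entries are at most [D] in absolute
   value and [c] counts all parameters, the radius [B + c * D] accommodates them. *)
have [A [C [A0 C0 bndA lipC]]] : _ := @network_bounds R L p pout f a (B + c * D%:R) a0
  (addr_ge0 B0 (mulr_ge0 c0 (ler0n _ _))) act.
exists A, (C * c), (D.+1 * #|S|)%N; split; rewrite ?mulr_ge0//.
move=> n n0; have n0R : 0 < n%:R :> R by rewrite ltr0n.
pose F : finType := {ffun S -> 'I_(2 * D * n).+1}.
pose Theta_ (q : F) : params R L p := fun l =>
  \matrix_(i, j) ((q (Tagged (fun l : 'I_L.+1 => ('I_(p l.+1) * 'I_(p l))%type) (i, j)))%:R
     / n%:R - D%:R).
have ThB q l : norm1 (Theta_ q l) <= B + c * D%:R.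
  apply: (@le_trans _ _ ((p l.+1 * p l)%N%:R * D%:R)).
    apply: natr_norm1_le => i j; rewrite mxE; set k := q _.
    rewrite ler_norml; apply/andP; split.
      by rewrite lerBrDr addNr divr_ge0// ltW.
    rewrite lerBlDr ler_pdivrMr//.
    have : (k%:R : R) <= (2 * D * n)%N%:R by rewrite ler_nat -ltnS.
    by rewrite !natrM; lra.
  by rewrite (@le_trans _ _ (c * D%:R)) ?ler_wpM2r// lerDr.
exists F, Theta_; split.
- rewrite card_ffun card_ord expnM.
  have [->|S0] := posnP #|S|; first by rewrite !expn0.
  rewrite leq_exp2r// expnS.
  (* Thus 2 D n + 1 <= 2 n (D + 1) <= (2 n)^(D + 1) for each coordinate. *)
  have nD : (D.+1 <= (2 * n) ^ D)%N.
    apply: (leq_trans (ltn_expl D (ltnSn 1))).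
    by rewrite leq_exp2r// leq_pmulr.
  apply: leq_trans (leq_mul (leqnn _) nD).
  by rewrite mulnS addnC mulnAC; nia.
- by move=> q x; apply: bndA.
move=> Theta TB.
have approx (s : S) : {j : 'I_(2 * D * n).+1 |
    `|Theta (tag s) (tagged s).1 (tagged s).2 - (j%:R / n%:R - D%:R)| <= n%:R^-1}.
  apply/cid/grid_approx => //.
  by apply: (le_trans (ler_norm1 _ _ _)); apply: le_trans BD.
exists [ffun s => projT1 (approx s)] => x.
rewrite -[C * c / _]mulrA; apply: lipC => //.
- by rewrite divr_ge0// ltW.
- by move=> l; rewrite (le_trans (TB l))// lerDl mulr_ge0.
move=> l; apply: (@le_trans _ _ ((p l.+1 * p l)%N%:R * n%:R^-1)).
  apply: natr_norm1_le => i j; rewrite !mxE ffunE.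
  exact: (projT2 (approx (Tagged (fun l : 'I_L.+1 => ('I_(p l.+1) * 'I_(p l))%type) (i, j)))).
by rewrite ler_wpM2r// invr_ge0 ltW.
Qed.

(** * The deterministic oracle inequality *)

(** The middle bracket depends neither on [k] nor on [h], and so cancels when two values of the
    objective are compared. *)
Lemma mean_sq_shift (R : realType) n (a h u : 'I_n -> R) (k : R) :
  mean_sq (fun i => a i + u i - k * h i) =
  mean_sq (fun i => a i - k * h i) + (mean_sq u + n%:R^-1 * (2 * \sum_i u i * a i))
    - k * (n%:R^-1 * (2 * \sum_i u i * h i)).
Proof.
rewrite /mean_sq [k * _]mulrCA -!mulrDr -mulrBr; congr (_ * _).
rewrite !mulr_sumr -!big_split /= -sumrB; apply: eq_bigr => i _; ring.
Qed.

Lemma mean_sq_ge0 (R : realType) n (v : 'I_n -> R) : 0 <= mean_sq v.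
Proof.
by rewrite /mean_sq mulr_ge0 ?invr_ge0// sumr_ge0// => i _; rewrite sqr_ge0.
Qed.

(** Comparing the objective at the estimator and at a competitor [t], the noise contributes at most
    lambda times each scale. For the estimator this is absorbed by its own penalty; for [t] it
    doubles the penalty. *)
Lemma oracle_inequality (R : realType) (L : nat) (p : nat -> nat)
    (pout : p L.+1 = 1%N) (f : forall l, 'cV[R]_(p l) -> 'cV[R]_(p l))
    (m : nat -> nat) (G : forall l, 'M[R]_(m l, p l.+1)) (nu : R)
    (g : 'cV[R]_(p 0%N) -> R) n (x : 'I_n -> 'cV[R]_(p 0%N)) (u : 'I_n -> R)
    (lambda : R) (est : R * params R L p) :
  (forall Theta : params R L p, reg G nu Theta <= 1 ->
    `|n%:R^-1 * (2 * \sum_i u i * network pout f Theta (x i))| <= lambda) ->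
  argmin (feasible G nu) (objective pout f x (fun i => g (x i) + u i) lambda) est ->
  err x g (fun z => est.1 * network pout f est.2 z) ^+ 2
    <= inf [set err x g (fun z => t.1 * network pout f t.2 z) ^+ 2
                + 2 * lambda * t.1 | t in feasible G nu].
Proof.
move=> noise [estF estmin].
(* The estimator itself shows that the infimum is over a nonempty set. *)
apply: lb_le_inf; first by eexists; exists est.
move=> _ [t tF <-]; have := estmin t tF; rewrite /objective !mean_sq_shift.
rewrite /err !sqr_sqrtr ?mean_sq_ge0//.
have [e0 /noise] := estF; have [t0 /noise] := tF; rewrite !ler_norml.
move=> /andP[h1 h2] /andP[h3 h4]; nra.
Qed.

(** * Input norms, the choice of the threshold, and degenerate cases *)

Lemma input_normP (R : realType) (d n : nat) (x : 'I_n -> 'cV[R]_d) : (0 < n)%N ->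
  \sum_i norm2 (x i) ^+ 2 = n%:R * input_norm x ^+ 2.
Proof.
move=> n0; rewrite sqr_sqrtr; first by rewrite mulrC divfK// pnatr_eq0 -lt0n.
by rewrite divr_ge0// sumr_ge0// => i _; rewrite sqr_ge0.
Qed.

Lemma norm2_le_input_norm (R : realType) (d n : nat) (x : 'I_n -> 'cV[R]_d) i :
  norm2 (x i) <= Num.sqrt n%:R * input_norm x.
Proof.
have n0 : (0 < n)%N := leq_ltn_trans (leq0n i) (ltn_ord i).
rewrite -(ler_pXn2r (_ : 0 < 2)%N) ?nnegrE ?norm2_ge0 ?mulr_ge0 ?sqrtr_ge0//.
rewrite exprMn [Num.sqrt n%:R ^+ 2]sqr_sqrtr// -input_normP// (bigD1 i)//= lerDl.
by rewrite sumr_ge0// => j _; rewrite sqr_ge0.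
Qed.

Lemma M_reg_ge0 (R : realType) (L : nat) (p m : nat -> nat)
    (G : forall l, 'M[R]_(m l, p l.+1)) : 0 <= M_reg L G.
Proof. exact: bigmax_ge_id. Qed.

Lemma prob_at_leastT d (T : measurableType d) (R : realType)
    (P : probability T R) (A : set T) (q : R) :
  (forall w, A w) -> q <= 1 -> prob_at_least P A q.
Proof.
move=> AT q1; exists setT; split=> //.
by rewrite probability_setT lee_fin.
Qed.

(** Here [a] is the size of the net and the added n counts the noise variables; the factor 2 n comes
    from the two signs and the target probability 1/n. *)
Lemma union_size_bound (a n b : nat) : (0 < n)%N -> (a <= (2 * n) ^ b)%N ->
  (2 * n * (a + n) <= (2 * n) ^ (b + 3))%N.
Proof.
move=> n0 ab.
have h1 : (a + n <= (2 * n) ^ b.+2)%N.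
  have h2 : ((2 * n) ^ b + n <= (2 * n) ^ b.+1 + (2 * n) ^ b.+1)%N.
    apply: leq_add; first by rewrite leq_pexp2l// muln_gt0.
    by rewrite expnS (leq_trans (leq_pmull n (ltn0Sn 1)))// leq_pmulr// expn_gt0 muln_gt0 n0.
  rewrite (leq_trans (leq_add ab (leqnn n)))// (leq_trans h2)//.
  by rewrite addnn -mul2n [leqRHS]expnS leq_mul2r leq_pmulr// orbT.
by rewrite addn3 expnS leq_mul2l h1 orbT.
Qed.

(** The exponent is quadratic in ln(2n). For large n one logarithm absorbs the constants, which
    leaves (b + 3) ln(2n), and (2n)^(-(b + 3)) beats the size of the union. *)
Lemma threshold_tail (R : realType) (be s c : R) (b n a : nat) :
  0 < be -> 0 < s -> 0 < c -> (0 < n)%N -> (a <= (2 * n) ^ b)%N ->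
  expR (4 * c * (b + 3)%N%:R / (be * s) ^+ 2) <= n%:R ->
  2 * (a + n)%N%:R * expR (- ((be * s * ln (2 * n)%N%:R) ^+ 2 / (4 * c))) <= n%:R^-1.
Proof.
move=> be0 s0 c0 n0 ab hn.
have n0R : 0 < n%:R :> R by rewrite ltr0n.
have n2R : 0 < (2 * n)%N%:R :> R by rewrite ltr0n muln_gt0.
set l := ln _; set k := (b + 3)%N.
have bs0 : 0 < (be * s) ^+ 2 by rewrite exprn_gt0// mulr_gt0.
have Ql : 4 * c * k%:R / (be * s) ^+ 2 <= l.
  rewrite -ler_expR /l lnK ?posrE//; apply: (le_trans hn).
  by rewrite ler_nat leq_pmull.
have l0 : 0 <= l.
  by apply: le_trans Ql; rewrite divr_ge0 ?(ltW bs0)// !mulr_ge0// ltW.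
have tail : k%:R * l <= (be * s * l) ^+ 2 / (4 * c).
  rewrite ler_pdivlMr ?mulr_gt0//.
  move: Ql; rewrite ler_pdivrMr// => Ql.
  have := ler_wpM2l l0 Ql; rewrite exprMn; lra.
apply: (@le_trans _ _ (2 * (a + n)%N%:R * expR (- (k%:R * l)))).
  by rewrite ler_wpM2l ?mulr_ge0// ler_expR lerN2.
rewrite expRN mulrC expRM_natl /l lnK ?posrE// -natrX.
rewrite ler_pdivrMl ?ltr0n ?expn_gt0 ?muln_gt0 ?n0//.
rewrite ler_pdivlMr// -!natrM ler_nat.
by apply: leq_trans (union_size_bound n0 ab); rewrite mulnAC.
Qed.

(** Used with [h] a network, [h'] its neighbor in the net and [e] the input norms. The sum against
    [h'] is one of the normalized combinations; the one against [h - h'] has n terms, each at most t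
    C r / n. *)
Lemma noise_bound (R : realType) (n : nat) (r A C t : R) (u e h h' : 'I_n -> R) :
  (0 < n)%N -> 0 < r -> 0 < A -> 0 <= C ->
  (forall i, `|u i| <= t) -> (forall i, e i <= r) ->
  (forall i, `|h i - h' i| <= C / n%:R * e i) ->
  `|\sum_i h' i / (A * r) * u i| <= t ->
  `|n%:R^-1 * (2 * \sum_i u i * h i)| <= 2 * t * (A + C) * r / n%:R.
Proof.
move=> n0 r0 A0 C0 ut er hh' ht.
have n0R : 0 < n%:R :> R by rewrite ltr0n.
have Ar0 : 0 < A * r by rewrite mulr_gt0.
have b1 : `|\sum_i u i * h' i| <= t * (A * r).
  have -> : \sum_i u i * h' i = (\sum_i h' i / (A * r) * u i) * (A * r).
    rewrite mulr_suml; apply: eq_bigr => i _.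
    by rewrite mulrAC divfK ?gt_eqF// mulrC.
  by rewrite normrM (gtr0_norm Ar0) ler_wpM2r// ltW.
have b2 : `|\sum_i u i * (h i - h' i)| <= t * (C * r).
  apply: (le_trans (ler_norm_sum _ _ _)).
  apply: (@le_trans _ _ (\sum_(i < n) t * (C / n%:R * r))).
    apply: ler_sum => i _; rewrite normrM ler_pM//.
    by rewrite (le_trans (hh' i))// ler_wpM2l// divr_ge0// ltW.
  rewrite sumr_const card_ord -[_ *+ n]mulr_natr le_eqVlt; apply/orP; left; apply/eqP.
  by field; rewrite gt_eqF.
have -> : \sum_i u i * h i = \sum_i u i * h' i + \sum_i u i * (h i - h' i).
  by rewrite -big_split; apply: eq_bigr => i _ /=; ring.
rewrite normrM gtr0_norm ?invr_gt0// mulrC ler_wpM2r ?invr_ge0 ?(ltW n0R)//.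
rewrite normrM ger0_norm// -!mulrA ler_wpM2l//.
apply: (le_trans (ler_normD _ _)); lra.
Qed.

(** Covers the cases of a zero Lipschitz constant and of zero inputs, where the lower bound on
    lambda is 0: the noise term vanishes and the inequality holds surely. *)
Lemma oracle_of_null_networks (R : realType) (L : nat) (p : nat -> nat)
    (pout : p L.+1 = 1%N) (f : forall l, 'cV[R]_(p l) -> 'cV[R]_(p l))
    (m : nat -> nat) (G : forall l, 'M[R]_(m l, p l.+1)) (nu : R)
    (g : 'cV[R]_(p 0%N) -> R) n (x : 'I_n -> 'cV[R]_(p 0%N)) (lambda : R)
    d (T : measurableType d) (P : probability T R) (u : 'I_n -> {RV P >-> R})
    (est : T -> R * params R L p) :
  0 <= lambda ->
  (forall Theta : params R L p, reg G nu Theta <= 1 ->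
    forall i, network pout f Theta (x i) = 0) ->
  (forall w, argmin (feasible G nu)
               (objective pout f x (fun i => g (x i) + u i w) lambda)
               (est w)) ->
  prob_at_least P
    [set w | err x g (fun z => (est w).1 * network pout f (est w).2 z) ^+ 2
             <= inf [set err x g (fun z => t.1 * network pout f t.2 z) ^+ 2
                         + 2 * lambda * t.1 | t in feasible G nu]]
    (1 - 1 / n%:R).
Proof.
move=> lam0 net0 est_min; apply: prob_at_leastT; last first.
  by rewrite lerBlDr lerDl divr_ge0.
move=> w; apply: (oracle_inequality _ (est_min w)) => Theta /net0 h.
by rewrite big1 ?mulr0 ?normr0// => i _; rewrite h mulr0.
Qed.

(** * Calibration of the constants and conclusion *)

Theorem theorem1 (R : realType) (K gamma : R) (K_gt0 : 0 < K)
    (gamma_gt0 : 0 < gamma) :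
  exists C : R, 0 < C /\
  forall (L : nat) (p : nat -> nat) (pout : p L.+1 = 1%N)
    (f : forall l, 'cV[R]_(p l) -> 'cV[R]_(p l)) (aLip : R)
    (m : nat -> nat) (G : forall l, 'M[R]_(m l, p l.+1)) (nu : R)
    (g : 'cV[R]_(p 0%N) -> R),
  (0 < L)%N ->
  (forall l, (1 <= l <= L)%N -> (0 < p l)%N) ->
  0 <= aLip ->
  (forall l, (1 <= l <= L)%N -> is_activation aLip (f l)) ->
  0 < nu ->
  M_reg L G < 1 ->
  1 / (1 - M_reg L G) <= nu ->
  exists N : R -> nat,
  (forall s t, 0 < s -> s <= t -> (N t <= N s)%N) /\
  forall (n : nat) (x : 'I_n -> 'cV[R]_(p 0%N)) (lambda : R),
  (0 < n)%N ->
  (N (input_norm x) <= n)%N ->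
  0 <= lambda ->
  C * (M_reg L G + 1) * aLip ^+ (2 * L) * input_norm x ^+ 2
    * (Num.sqrt 2 / L%:R) ^+ (2 * L - 1)
    * Num.sqrt (ln (2 * nparams L p)%N%:R)
    * (ln (2 * n)%N%:R / Num.sqrt n%:R) <= lambda ->
  forall (d : measure_display) (T : measurableType d) (P : probability T R)
    (u : 'I_n -> {RV P >-> R}),
  independent_rvs u ->
  (forall i, ('E_P[u i] = 0)%E) ->
  subgaussian K gamma u ->
  forall est : T -> R * params R L p,
  (forall w, argmin (feasible G nu)
               (objective pout f x (fun i => g (x i) + u i w) lambda)
               (est w)) ->
  prob_at_least P
    [set w | err x g (fun z => (est w).1 * network pout f (est w).2 z) ^+ 2
             <= inf [set err x g (fun z => t.1 * network pout f t.2 z) ^+ 2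
                         + 2 * lambda * t.1 | t in feasible G nu]]
    (1 - 1 / n%:R).
Proof.
exists 1; split=> // L p pout f a m G nu g L0 p0 a0 act nu0 _ _.
have [a_eq0|a_neq0] := eqVneq a 0.
  exists (fun=> 0%N); split=> // n x lambda _ _ lam0 _ d T P u _ _ _ est est_min.
  apply: oracle_of_null_networks lam0 _ est_min => Theta _ i.
  by apply: network_lip0 => // l hl; rewrite -a_eq0; exact: act.
have a_gt0 : 0 < a by rewrite lt_neqAle eq_sym a_neq0.
have [B [B0 regB]] := reg_bounded L G nu0.
have [A [C [b [A0 C0 net]]]] := network_net pout a0 B0 act.
pose c := K ^+ 2 + 2 * gamma ^+ 2.
have c0 : 0 < c by rewrite ltr_pwDl// ?exprn_gt0// mulr_ge0// sqr_ge0.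
(* The assumed lower bound on lambda is [kap] times s^2 ln(2n) / sqrt n. *)
pose kap := (M_reg L G + 1) * a ^+ (2 * L) * (Num.sqrt 2 / L%:R) ^+ (2 * L - 1)
    * Num.sqrt (ln (2 * nparams L p)%N%:R).
have kap0 : 0 < kap.
  have np : (0 < nparams L p)%N.
    rewrite /nparams (bigD1 ord_max)//= pout mul1n addn_gt0.
    by rewrite (p0 L)// L0 leqnn.
  rewrite /kap !mulr_gt0//.
  - by rewrite ltr_wpDl// M_reg_ge0.
  - by rewrite exprn_gt0.
  - by rewrite exprn_gt0// divr_gt0 ?sqrtr_gt0// ltr0n.
  - by rewrite sqrtr_gt0 ln_gt0// ltr1n leq_pmulr.
(* Chosen so that the level t = be s ln(2n) turns the bound of [noise_bound] into exactly the lower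
   bound on lambda. Using A + 1 in place of A allows division by it. *)
pose be := kap / (2 * (A + 1 + C)).
have AC0 : 0 < A + 1 + C by lra.
have be0 : 0 < be by rewrite divr_gt0// mulr_gt0.
pose Q (s : R) := 4 * c * (b + 3)%N%:R / (be * s) ^+ 2.
(* The successor compensates for the truncation, so that n >= N s implies n >= exp(Q s). *)
exists (fun s => (Num.truncn (expR (Q s))).+1); split.
  move=> s t s0 st; rewrite ltnS le_truncn// ler_expR /Q.
  have t0 : 0 < t by exact: lt_le_trans st.
  rewrite ler_wpM2l// ?mulr_ge0 ?(ltW c0)//.
  have bs0 : 0 < be * s := mulr_gt0 be0 s0.
  have bst : be * s <= be * t by rewrite ler_pM2l.
  have bt0 : 0 < be * t := lt_le_trans bs0 bst.
  rewrite lef_pV2 ?posrE ?exprn_gt0//.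
  by rewrite ler_pXn2r// nnegrE ltW.
move=> n x lambda n0 Nn lam0 lam_ge d T P u indep u0 subG est est_min.
have n0R : 0 < n%:R :> R by rewrite ltr0n.
set s := input_norm x in Nn lam_ge.
have s_ge0 : 0 <= s by exact: sqrtr_ge0.
have [F [ThF [cardF netA netC]]] := net _ n0.
(* If s = 0 all inputs are zero, and the growth and approximation bounds of the net force every
   feasible network to vanish there. *)
have [s_eq0|s_neq0] := eqVneq s 0.
  apply: oracle_of_null_networks lam0 _ est_min => Theta /regB /netC [q Hq] i.
  have xi0 : norm2 (x i) = 0.
    apply/eqP; rewrite eq_le norm2_ge0 andbT.
    by have := norm2_le_input_norm x i; rewrite -/s s_eq0 mulr0.
  have := Hq (x i); have := netA q (x i); rewrite xi0 !mulr0 normr_le0 => /eqP ->.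
  by rewrite subr0 normr_le0 => /eqP.
have s0 : 0 < s by rewrite lt_neqAle eq_sym s_neq0.
pose sn := Num.sqrt (n%:R : R).
have sn0 : 0 < sn by rewrite sqrtr_gt0.
have snn : sn * sn = n%:R by rewrite -expr2 sqr_sqrtr// ltW.
pose r := sn * s.
have r0 : 0 < r by rewrite mulr_gt0.
(* The weights [inr j] single out [u j]. *)
pose v (q : (F + 'I_n)%type) (i : 'I_n) : R := match q with
  | inl q => network pout f (ThF q) (x i) / ((A + 1) * r)
  | inr j => (i == j)%:R end.
have A10 : 0 < A + 1 by lra.
(* For a network, the growth bound applies, and r^2 = n s^2 is the sum of the squared input
   norms. *)
have v1 q : \sum_i v q i ^+ 2 <= 1.
  case: q => [q|j] /=; last first.
    rewrite (bigD1 j)//= eqxx expr1n big1 ?addr0// => i /negbTE ->.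
    by rewrite expr0n.
  under eq_bigr do rewrite expr_div_n.
  rewrite -mulr_suml ler_pdivrMr ?exprn_gt0 ?mulr_gt0// mul1r.
  apply: (@le_trans _ _ (\sum_i (A + 1) ^+ 2 * norm2 (x i) ^+ 2)).
    apply: ler_sum => i _; rewrite -exprMn -[leLHS]real_normK ?num_real//.
    rewrite ler_pXn2r ?nnegrE ?mulr_ge0 ?norm2_ge0 ?(ltW A10)//.
    apply: (le_trans (netA q (x i))); rewrite ler_wpM2r ?norm2_ge0//; lra.
  rewrite -mulr_sumr input_normP// -/s exprMn ler_wpM2l ?sqr_ge0//.
  by rewrite /r exprMn [sn ^+ 2]expr2 snn.
pose t := be * s * ln (2 * n)%N%:R.
have t0 : 0 < t.
  by apply: (mulr_gt0 (mulr_gt0 be0 s0)); rewrite ln_gt0// ltr1n leq_pmulr.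
have [E [mE HE PE]] := weighted_sums_event K_gt0 indep u0 subG v1 t0.
exists E; split=> //; last first.
  apply: le_trans PE; rewrite lee_fin lerD2l lerN2 div1r card_sum card_ord.
  apply: (@threshold_tail _ be s c b n #|F|) => //.
  by rewrite ltW// (lt_le_trans (truncnS_gt _))// ler_nat.
move=> w Ew; apply: (oracle_inequality _ (est_min w)) => Theta /regB /netC [q Hq].
have ut i : `|u i w| <= t.
  have := HE w (inr i) Ew; rewrite /v (bigD1 i)//= eqxx mul1r big1 ?addr0//.
  by move=> j /negbTE ->; rewrite mul0r.
have er i : norm2 (x i) <= r by exact: norm2_le_input_norm.
have ht := HE w (inl q) Ew.
apply: (le_trans (noise_bound n0 r0 A10 C0 ut er (fun i => Hq (x i)) ht)).
apply: le_trans lam_ge; rewrite -/sn mul1r.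
(* Since r / n = s / sqrt n, both sides agree by the choice of [be]. *)
have shuffle (X Y Z S W : R) : X * S * Y * Z * W = X * Y * Z * (S * W) by ring.
have cancel (k D S l z : R) : D != 0 -> z != 0 ->
    2 * (k / (2 * D) * S * l) * D * (z * S) / (z * z) = k * (S ^+ 2 * (l / z)).
  by move=> D0 z0; field; rewrite z0.
rewrite [leRHS]shuffle -snn -[leRHS](cancel _ _ _ _ _ (lt0r_neq0 AC0) (lt0r_neq0 sn0)).
exact: lexx.
Qed.
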